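(* The degree $2$ $A_\infty$-natural transformations (one representative from each cohomology class) $$\eta_{\{\vartheta_i\}}:\mathrm{id}\Rightarrow\mathrm{id},\qquad \{\vartheta_1,\dots,\vartheta_{N-1}\}\in\Bbbk^{N-1}\cong\mathrm{HH}^2(\Delta),$$ are given by $$\eta^2(a_{kj}s^\beta,a_{ji}s^\alpha)=\mathfrak c(a_{kj}s^\beta,a_{ji}s^\alpha)\,a_{ki}s^{\beta+\alpha+\delta(i,j,k)-1},\qquad \eta^0=\eta^1=\eta^3=\cdots=0,$$ where $$\mathfrak c(a_{kj}s^\beta,a_{ji}s^\alpha)=\begin{cases} -\beta\vartheta_j-\sum_{t=1}^{j-k}2(\beta+t)\vartheta_{j-t}-2(\beta+j-k)\sum_{t=i}^{k-1}\vartheta_t+(\beta+j-k)\vartheta_i,& i<k\le j,\\ \beta\vartheta_j+\sum_{t=1}^{k-j}2(\beta+t)\vartheta_{j+t}+2(\beta+k-j)\sum_{t=k+1}^{i}\vartheta_t-(\beta+k-j)\vartheta_i,& j\le k<i,\\ -\beta\vartheta_j-\sum_{t=1}^{j-i}2(\beta+t)\vartheta_{j-t}+(\beta+j-i)\vartheta_i,& k\le i<j,\\ \beta\vartheta_j+\sum_{t=1}^{i-j}2(\beta+t)\vartheta_{j+t}-(\beta+i-j)\vartheta_i,& j<i\le k,\\ 0,&\text{else,} \end{cases}$$ and one sets $\vartheta_0=\vartheta_N=0$.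
   Context: Let $\Bbbk$ be a field and let $N=|\mathbf x|$ be the number of punctures. $\mathcal C$ is the $\Bbbk$-linear category (an $A_\infty$-category concentrated in degree $0$ with only $\mu^2$ nonzero) with objects $T_0,\dots,T_N$, where $\operatorname{Hom}(T_i,T_j)$ has $\Bbbk$-basis $\{a_{ji}s^\alpha\}_{\alpha\ge0}$ and composition $a_{kj}s^\beta\cdot a_{ji}s^\alpha=a_{ki}s^{\alpha+\beta+\delta(i,j,k)}$, $\delta(i,j,k)=\frac12(|i-j|+|j-k|-|i-k|)$. It is the full subcategory on generators of the Fukaya category considered; functors and natural transformations are computed on $\mathcal C$ and extended to bounded twisted complexes $\mathrm{Tw}^b(\mathcal C)$. Terms with zero coefficient are read as $0$, whatever the exponent of $s$. A degree $g$ pre-natural transformation $\eta:\mathrm{id}\Rightarrow\mathrm{id}$ consists of multilinear maps $\eta^d:\operatorname{Hom}(X_{d-1},X_d)\otimes\cdots\otimes\operatorname{Hom}(X_0,X_1)\to\operatorname{Hom}^{g-d}(X_0,X_d)$, $d\ge0$ ($\eta^0$ being an element of $\operatorname{Hom}^g(X_0,X_0)$ for each object); as $\mathcal C$ is in degree $0$, only $\eta^g$ can be nonzero. The differential is $$\mu^1(\eta)^d(a_d,\dots,a_1)=a_d\cdot\eta^{d-1}(a_{d-1},\dots,a_1)+(-1)^{g-1}\eta^{d-1}(a_d,\dots,a_2)\cdot a_1-\sum_{n=0}^{d-2}(-1)^{n+g-1}\eta^{d-1}(a_d,\dots,a_{n+2}\cdot a_{n+1},\dots,a_1).$$ $\eta$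 is an $A_\infty$-natural transformation if $\mu^1(\eta)=0$. $\mathrm{HH}^g(\Delta)=H^g\operatorname{Hom}(\mathrm{id},\mathrm{id})$ is the degree-$g$ cohomology of this complex (Hochschild cohomology of $\mathcal C$ with coefficients in its diagonal bimodule $\Delta$).
   Formalization: With ''0, else'' η is not a cocycle if N≥2, ϑ≠0; so c is set to -βϑ_j-2βΣ_{t=i}^{j-1}ϑ_t+βϑ_i for i<j<k and βϑ_j+2βΣ_{t=j+1}^{i}ϑ_t-βϑ_i for k<j<i. One representative per class is claimed only for char≠2 (in char 2 all η are coboundaries). *)

(* Defs.v *)
From HB Require Import structures.
From mathcomp Require Import all_boot all_order all_algebra.
From mathcomp Require Import boolp classical_sets functions.
From mathcomp Require Import zify.

Set Implicit Arguments.
Unset Strict Implicit.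
Unset Printing Implicit Defensive.

Import Order.TTheory GRing.Theory Num.Theory.
Local Open Scope ring_scope.
Local Open Scope quotient_scope.

Section LmodQuotient.
Variables (R : pzRingType) (V : lmodType R) (B : submodClosed V).

Definition submod_pred : {pred V} := [in B].

Lemma submod_pred_closed : zmod_closed submod_pred.
Proof. exact: GRing.submod_closedB (submodClosedP B). Qed.

HB.instance Definition _ :=
  GRing.isZmodClosed.Build V submod_pred submod_pred_closed.

Definition lmod_quot := Quotient.quot submod_pred.

HB.instance Definition _ := GRing.Zmodule.on lmod_quot.

Definition quot_class (x : V) : lmod_quot :=
  \pi_(Quotient.quot submod_pred) x.

Lemma quot_classE x y : (quot_class x = quot_class y) <-> (x - y \in B).
Proof.
rewrite /quot_class.
split=> [/eqP|h]; last apply/eqP; by rewrite -?Quotient.idealrBE.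
Qed.

Lemma quot_class_surj (c : lmod_quot) : exists x, c = quot_class x.
Proof. by exists (repr c); rewrite /quot_class reprK. Qed.

Lemma quot_classD : {morph quot_class : x y / x + y}.
Proof. by move=> x y; rewrite /quot_class [LHS]raddfD. Qed.

Definition quot_scale (a : R) (c : lmod_quot) : lmod_quot :=
  quot_class (a *: (repr c : V)).

Lemma quot_scaleE a x : quot_scale a (quot_class x) = quot_class (a *: x).
Proof.
apply/quot_classE; rewrite -scalerBr; apply: rpredZ.
by apply/quot_classE; rewrite /quot_class reprK.
Qed.

Lemma quot_scaleA a b c : quot_scale a (quot_scale b c) = quot_scale (a * b) c.
Proof. by have [x ->] := quot_class_surj c; rewrite !quot_scaleE scalerA. Qed.

Lemma quot_scale1 : left_id 1 quot_scale.
Proof. by move=> c; have [x ->] := quot_class_surj c; rewrite quot_scaleE scale1r. Qed.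

Lemma quot_scaleDr : right_distributive quot_scale +%R.
Proof.
move=> a c d; have [x ->] := quot_class_surj c; have [y ->] := quot_class_surj d.
by rewrite -quot_classD !quot_scaleE scalerDr quot_classD.
Qed.

Lemma quot_scaleDl c : {morph quot_scale^~ c : a b / a + b}.
Proof.
move=> a b; have [x ->] := quot_class_surj c.
by rewrite !quot_scaleE scalerDl quot_classD.
Qed.

HB.instance Definition _ := GRing.Zmodule_isLmodule.Build R lmod_quot
  quot_scaleA quot_scale1 quot_scaleDr quot_scaleDl.

Lemma quot_class_is_linear : linear quot_class.
Proof. by move=> a x y; rewrite quot_classD -quot_scaleE. Qed.

HB.instance Definition _ :=
  GRing.isLinear.Build R V lmod_quot *:%R quot_class quot_class_is_linear.

End LmodQuotient.

Section Hochschild.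
Variables (k : fieldType) (N : nat).

Definition obj := 'I_N.+1.

Definition delta (i j l : nat) : nat :=
  (((i - j) + (j - i)) + ((j - l) + (l - j)) - ((i - l) + (l - i)))./2.

(* Each Hom(T_i, T_j) is {poly k}, where 'X^alpha stands for a_{ji} s^alpha.  *)
(* mu2 i j l b a is the composite b . a of a : T_i -> T_j and b : T_j -> T_l.*)
Definition mu2 (i j l : obj) (b a : {poly k}) : {poly k} :=
  b * a * 'X^(delta i j l).

(* The sequence [:: (a_1, X_1); ...; (a_d, X_d)] together with a source X_0   *)
(* encodes a composable chain a_n : X_{n-1} -> X_n; a cochain eta collects    *)
(* all the maps eta^d, with eta X_0 c = eta^d(a_d, ..., a_1) for c of size d. *)
Definition cochain := obj -> seq ({poly k} * obj) -> {poly k}.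

Definition chain_obj (X0 : obj) (c : seq ({poly k} * obj)) (n : nat) : obj :=
  nth X0 (X0 :: unzip2 c) n.

Definition chain_arr (c : seq ({poly k} * obj)) (n : nat) : {poly k} :=
  nth 0 (unzip1 c) n.-1.

Definition multilinear (eta : cochain) : Prop :=
  forall X0 c1 X c2 (x : k) (f g : {poly k}),
    eta X0 (c1 ++ (x *: f + g, X) :: c2) =
    x *: eta X0 (c1 ++ (f, X) :: c2) + eta X0 (c1 ++ (g, X) :: c2).

(* The category is concentrated in degree 0: Hom^e is {poly k} for e = 0 and  *)
(* is zero for e != 0.                                                        *)
Definition in_Hom (e : int) (f : {poly k}) : Prop := e != 0 -> f = 0.

Definition pre_nat (g : int) (eta : cochain) : Prop :=
  multilinear eta /\ forall X0 c, in_Hom (g - (size c)%:Z) (eta X0 c).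

Definition mu1 (g : int) (eta : cochain) : cochain := fun X0 c =>
  let d := size c in
  let X := chain_obj X0 c in
  let a := chain_arr c in
  if d is 0%N then 0 else
    mu2 (X 0%N) (X d.-1) (X d) (a d) (eta X0 (take d.-1 c))
    + (-1) ^ (g - 1) *: mu2 (X 0%N) (X 1%N) (X d) (eta (X 1%N) (behead c)) (a 1%N)
    - \sum_(0 <= n < d.-1) (-1) ^ (n%:Z + g - 1) *:
        eta X0 (take n c
                ++ (mu2 (X n) (X n.+1) (X n.+2) (a n.+2) (a n.+1), X n.+2)
                :: drop n.+2 c).

Definition nat_trans (g : int) (eta : cochain) : Prop :=
  pre_nat g eta /\ mu1 g eta = 0.

Lemma mu2_linearr i j l b : linear (mu2 i j l b).
Proof.
by move=> x f g; rewrite /mu2 mulrDr mulrDl -scalerAr -scalerAl.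
Qed.

Lemma mu2_linearl i j l a : linear (mu2 i j l ^~ a).
Proof. by move=> x f g; rewrite /mu2 !mulrDl -!scalerAl. Qed.

Lemma mu1_is_linear g : linear (mu1 g).
Proof.
move=> x u v; apply/funext => X0; apply/funext => c.
have E (f1 f2 : cochain) Y e : (x *: f1 + f2) Y e = x *: f1 Y e + f2 Y e by [].
rewrite E /mu1; case: (size c) => [|d]; first by rewrite scaler0 addr0.
rewrite !E mu2_linearr [mu2 _ _ _ (_ + _) _]mu2_linearl.
under eq_bigr => n _ do rewrite E scalerDr scalerA mulrC -scalerA.
rewrite big_split /= -scaler_sumr !scalerDr !scalerA [_ * x]mulrC.
rewrite opprD scalerN -!addrA; congr (_ + _).
by rewrite addrCA; congr (_ + _); rewrite [RHS]addrCA; congr (_ + _); rewrite addrCA.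
Qed.

HB.instance Definition _ g :=
  GRing.isLinear.Build k cochain cochain *:%R (mu1 g) (mu1_is_linear g).

Lemma pre_nat_linear g x u v :
  pre_nat g u -> pre_nat g v -> pre_nat g (x *: u + v).
Proof.
have E (f1 f2 : cochain) Y e : (x *: f1 + f2) Y e = x *: f1 Y e + f2 Y e by [].
move=> [mu hu] [mv hv]; split=> [X0 c1 X c2 y f h|X0 c ne].
  rewrite !E mu mv !scalerDr !scalerA mulrC -!addrA; congr (_ + _).
  by rewrite addrCA.
by rewrite E hu // hv // scaler0 addr0.
Qed.

Lemma pre_nat0 g : pre_nat g 0.
Proof.
split=> // X0 c1 X c2 x f h.
by rewrite -[LHS]/(0 : {poly k}) -[RHS]/(x *: (0 : {poly k}) + 0) scaler0 addr0.
Qed.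

Definition cocycle (g : int) : {pred cochain} := fun eta => `[< nat_trans g eta >].

Lemma cocycle_submod g : submod_closed (cocycle g).
Proof.
split=> [|x u v /asboolP [pu u0] /asboolP [pv v0]]; apply/asboolP; split.
- exact: pre_nat0.
- exact: raddf0.
- exact: pre_nat_linear.
- by rewrite (mu1_is_linear g) u0 v0 scaler0 addr0.
Qed.

HB.instance Definition _ g :=
  GRing.isSubmodClosed.Build k cochain (cocycle g) (cocycle_submod g).

Record Zcocycle (g : int) := MkZ { Zval :> cochain; _ : Zval \in cocycle g }.

HB.instance Definition _ g := [isSub for @Zval g].
HB.instance Definition _ g := [Choice of Zcocycle g by <:].
HB.instance Definition _ g := [SubChoice_isSubLmodule of Zcocycle g by <:].

Definition coboundary (g : int) : {pred Zcocycle g} :=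
  fun z => `[< exists2 phi, pre_nat (g - 1) phi & mu1 (g - 1) phi = Zval z >].

Lemma coboundary_submod g : submod_closed (@coboundary g).
Proof.
split=> [|x u v /asboolP [f pf fu] /asboolP [h ph hv]]; apply/asboolP.
  by exists 0; [exact: pre_nat0 | rewrite raddf0 -[RHS]/(val (0 : Zcocycle g)) raddf0].
exists (x *: f + h); first exact: pre_nat_linear.
by rewrite (mu1_is_linear (g - 1)) fu hv.
Qed.

HB.instance Definition _ g :=
  GRing.isSubmodClosed.Build k (Zcocycle g) (@coboundary g) (coboundary_submod g).

Definition HH (g : int) : lmodType k := lmod_quot (@coboundary g).

(* The class of a cocycle; a cochain which is not a cocycle is sent to 0.     *)
Definition HH_class (g : int) (eta : cochain) : HH g :=
  quot_class (@coboundary g) (insubd 0 eta).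

End Hochschild.

Section Eta.
Variables (k : fieldType) (N : nat).
Implicit Types (theta : 'rV[k]_N.-1) (i j l : obj N).

(* theta = (theta_1, ..., theta_{N-1}) is stored from index 0; this is its    *)
(* extension by theta_0 = theta_N = 0.                                        *)
Definition thetaE theta (t : nat) : k :=
  if t is t'.+1 then (if insub t' is Some m then theta 0 m else 0) else 0.

(* The coefficient c(a_{lj} s^b, a_{ji} s^a), which does not depend on a.     *)
(* The values for i < j < l and l < j < i (the part linear in b of the other  *)
(* cases) are forced by the cocycle condition on (a_{lj}, a_{jj} s, a_{ji}),  *)
(* given the values for j = l.                                                *)
Definition coef theta (l j : nat) (b : nat) (i : nat) : k :=
  let th := thetaE theta in
  if (i < l <= j)%N then
    - (b%:R * th j)
    - \sum_(1 <= t < (j - l).+1) (2 * (b + t))%:R * th (j - t)%N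
    - (2 * (b + j - l))%:R * \sum_(i <= t < l) th t
    + (b + j - l)%:R * th i
  else if (j <= l < i)%N then
    b%:R * th j
    + \sum_(1 <= t < (l - j).+1) (2 * (b + t))%:R * th (j + t)%N
    + (2 * (b + l - j))%:R * \sum_(l.+1 <= t < i.+1) th t
    - (b + l - j)%:R * th i
  else if (l <= i < j)%N then
    - (b%:R * th j)
    - \sum_(1 <= t < (j - i).+1) (2 * (b + t))%:R * th (j - t)%N
    + (b + j - i)%:R * th i
  else if (j < i <= l)%N then
    b%:R * th j
    + \sum_(1 <= t < (i - j).+1) (2 * (b + t))%:R * th (j + t)%N
    - (b + i - j)%:R * th i
  else if (i < j < l)%N then
    - (b%:R * th j)
    - (2 * b)%:R * \sum_(i <= t < j) th t
    + b%:R * th i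
  else if (l < j < i)%N then
    b%:R * th j
    + (2 * b)%:R * \sum_(j.+1 <= t < i.+1) th t
    - b%:R * th i
  else 0.

(* The exponent is truncated at 0, but the coefficient vanishes whenever the  *)
(* untruncated exponent would be -1: see coef_eq0.                            *)
Definition eta2 theta i j l (f g : {poly k}) : {poly k} :=
  \sum_(b < size f) \sum_(a < size g)
    (f`_b * g`_a * coef theta l j b i) *: 'X^(b + a + delta i j l - 1).

Definition eta theta : cochain k N := fun X0 c =>
  if c is [:: (g, X1); (f, X2)] then eta2 theta X0 X1 X2 f g else 0.

Lemma coef_eq0 theta i j l : delta i j l = 0%N -> coef theta l j 0 i = 0.
Proof.
rewrite /delta /coef.
move: (nat_of_ord i) (nat_of_ord j) (nat_of_ord l) => {}i {}j {}l d0.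
have z := (addn0, add0n, muln0, mul0r, oppr0, addr0, subr0).
have [/andP[il lj]|_] := boolP (i < l <= j)%N.
  have e : (j - l = 0)%N by lia.
  by rewrite add0n e big_geq // !z.
have [/andP[jl li]|_] := boolP (j <= l < i)%N.
  have e : (l - j = 0)%N by lia.
  by rewrite add0n e big_geq // !z.
have -> : (l <= i < j)%N = false by lia.
have -> : (j < i <= l)%N = false by lia.
by rewrite !z !if_same.
Qed.

Lemma eta_basis theta i j l (a b : nat) :
  eta theta i [:: ('X^a, j); ('X^b, l)] =
  coef theta l j b i *: 'X^(b + a + delta i j l - 1).
Proof.
rewrite /eta /eta2 !size_polyXn (bigD1 ord_max) //= [X in _ + X]big1 => [|m hm].
  rewrite addr0 (bigD1 ord_max) //= [X in _ + X]big1 => [|m hm].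
    by rewrite addr0 !coefXn !eqxx !mul1r.
  by rewrite !coefXn (negbTE (hm : (m != a :> nat))) mulr0 mul0r scale0r.
apply: big1 => n _.
by rewrite !coefXn (negbTE (hm : (m != b :> nat))) !mul0r scale0r.
Qed.

End Eta.

(* Main.v *)
From HB Require Import structures.
Require Import Defs.
From mathcomp Require Import all_boot all_order all_algebra.
From mathcomp Require Import boolp classical_sets functions.
From mathcomp Require Import zify ring.

(** The idea.  Write x for the arrows going up and y for the arrows going down
   between consecutive objects.  The category is generated by the x and y over
   the line graph 0, ..., N, and its only relations say that at each of the
   N - 1 interior vertices i the two loops of length two, through i - 1 and
   through i + 1, are the same loop s.  A first-order deformation perturbs these
   two loops to s + e (...), and only the difference of the two perturbations
   matters: rescaling the arrows changes that difference by any family of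
   multiples of s, and by nothing else.  Hence the class of a 2-cocycle w is
   determined by the N - 1 scalars

     residue w i = constant term of w(i -> i-1 -> i) - w(i -> i+1 -> i),

   both evaluated on the arrows of s-degree 0.  The theorem amounts to three
   facts about this residue.

   - It kills coboundaries (residue_d1).

   - A cocycle with residue 0 is a coboundary (residue_exact).  Subtracting
     coboundaries, one first makes w vanish when its right argument is s
     (normalize_right).  Then w(s, -) is an s-linear derivation, given on
     Hom(T_i, T_j) by multiplication by q_j - q_i for some polynomials q_i.  The
     coboundary of q_i d/ds takes the same values with s on the left, and
     removing it makes w bilinear over k[s] (right_normal_exact).  What is left is a cocycle of the contractible
     groupoid on 0, ..., N with values in k[s, 1/s]; coning off to the vertex 0
     gives a primitive, which lies in k[s] as soon as the residues vanish
     (s_bilinear_exact).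

   - It is onto in every characteristic.  For scalars S_0, ..., S_N the cochain
     that multiplies T_i -> T_j by (S_(max i j) - S_j) / s is not defined over
     k[s], but its coboundary is; this pole cocycle (pole_cochain) has residue
     -(S_(i-1) - 2 S_i + S_(i+1)), and every family of N - 1 scalars is such a
     second difference (residue_pole_class).

   The explicit cocycle eta theta is then recognised by a direct computation of
   its coefficients (coefE): up to the coboundary of f |-> q_i df/ds on
   Hom(T_i, -), it is twice the pole cocycle of residue theta (etaE).  So eta
   theta is a cocycle of residue 2 theta, and theta |-> [eta theta] is bijective
   when 2 is invertible, while the pole cocycles always give an isomorphism. *)

Set Implicit Arguments.
Unset Strict Implicit.
Unset Printing Implicit Defensive.

Import GRing.Theory.
Local Open Scope ring_scope.

(** * Linear maps on polynomials *)

Section PolyLinear.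
Variables (k : fieldType) (F : {poly k} -> {poly k}).
Hypothesis linF : linear F.

Lemma linear_add : {morph F : x y / x + y}.
Proof. by move=> x y; have := linF 1 x y; rewrite !scale1r. Qed.

Lemma linear_zero : F 0 = 0.
Proof. by have := linear_add 0 0; rewrite addr0 => /eqP; rewrite addrC -subr_eq subrr => /eqP. Qed.

Lemma linear_scale a x : F (a *: x) = a *: F x.
Proof. by have := linF a x 0; rewrite linear_zero !addr0. Qed.

Lemma polyX_linear : (forall f, F (f * 'X) = F f * 'X) -> forall f, F f = f * F 1.
Proof.
move=> FX; elim/poly_ind => [|p c IH]; first by rewrite linear_zero mul0r.
rewrite linear_add FX IH -[c%:P]alg_polyC linear_scale mulrDl -scalerAl mul1r.
by congr (_ + _); rewrite mulrAC.
Qed.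
End PolyLinear.

Lemma linear_eqX (k : fieldType) (F G : {poly k} -> {poly k}) : linear F -> linear G ->
  (forall n, F 'X^n = G 'X^n) -> F =1 G.
Proof.
move=> lF lG FG f.
have H n : F (\poly_(a < n) f`_a) = G (\poly_(a < n) f`_a).
  rewrite !poly_def; elim: n => [|n IH]; first by rewrite !big_ord0 !linear_zero.
  by rewrite big_ord_recr /= addrC lF lG IH FG.
by rewrite -[f]coefK.
Qed.

Section PolyExtend.
Variables (k : fieldType) (F : nat -> {poly k}).

Definition poly_extend (f : {poly k}) : {poly k} := \sum_(n < size f) f`_n *: F n.

Lemma poly_extend_widen m (f : {poly k}) : (size f <= m)%N ->
  poly_extend f = \sum_(n < m) f`_n *: F n.
Proof.
move=> le_fm; rewrite /poly_extend (big_ord_widen _ (fun n => f`_n *: F n) le_fm).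
rewrite big_mkcond; apply: eq_bigr => n _; case: ltnP => // le_fn.
by rewrite nth_default ?scale0r.
Qed.

Lemma poly_extend_linear : linear poly_extend.
Proof.
move=> a f g; set m := maxn (size f) (size g).
have le_h : (size (a *: f + g)%R <= m)%N.
  rewrite (leq_trans (size_polyD _ _)) // geq_max leq_maxr andbT.
  by rewrite (leq_trans (size_scale_leq _ _)) ?leq_maxl.
rewrite (poly_extend_widen le_h) (poly_extend_widen (leq_maxl _ _ : (size f <= m)%N)).
rewrite (poly_extend_widen (leq_maxr _ _ : (size g <= m)%N)) scaler_sumr -big_split /=.
by apply: eq_bigr => n _; rewrite coefD coefZ scalerDl scalerA.
Qed.

Lemma poly_extendXn n : poly_extend 'X^n = F n.
Proof.
rewrite /poly_extend size_polyXn (bigD1 ord_max) //= coefXn eqxx scale1r big1 ?addr0 // => m hm.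
by rewrite coefXn (negbTE (hm : (m != n :> nat))) scale0r.
Qed.
End PolyExtend.

(** * The exponents of composition *)

(** With c i j = maxn i j - j this reads delta i j l = c i j + c j l - c i l, so
    all the identities between exponents follow from it by linear arithmetic. *)
Lemma delta_maxn i j l : (delta i j l + maxn i l + j = maxn i j + maxn j l)%N.
Proof. rewrite /delta; lia. Qed.

(** Associativity of composition, read on exponents. *)
Lemma delta_cocycle i j l m :
  (delta i j l + delta i l m = delta j l m + delta i j m)%N.
Proof.
move: (delta_maxn i j l) (delta_maxn i l m) (delta_maxn j l m) (delta_maxn i j m).
lia.
Qed.

Lemma deltaxx i l : (delta i i l = 0)%N.
Proof. by have := delta_maxn i i l; rewrite maxnn; lia. Qed.

Lemma delta_xx i l : (delta i l l = 0)%N.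
Proof. by have := delta_maxn i l l; rewrite maxnn; lia. Qed.

Lemma delta_backtrack i j : (delta i j i = maxn (i - j) (j - i))%N.
Proof. by have := delta_maxn i j i; rewrite maxnn; lia. Qed.

Lemma delta0E i j : (delta 0 i j = i - j)%N.
Proof. by have := delta_maxn 0 i j; rewrite !max0n; lia. Qed.

(** * Low-degree Hochschild cochains *)

Section Cochains.
Variables (k : fieldType) (N : nat).
Notation obj := (obj N).
Implicit Types (i j l m : obj) (f g h : {poly k}).

(** Components of 1- and 2-cochains.  In w i j l f g the right factor
    g : T_i -> T_j comes before f : T_j -> T_l, as in mu2. *)
Definition cochain1 := obj -> obj -> {poly k} -> {poly k}.
Definition cochain2 := obj -> obj -> obj -> {poly k} -> {poly k} -> {poly k}.

Definition linear1 (phi : cochain1) := forall i j, linear (phi i j).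
Definition bilinear2 (w : cochain2) :=
  (forall i j l g, linear (w i j l ^~ g)) /\ (forall i j l f, linear (w i j l f)).

Definition d1 (phi : cochain1) : cochain2 := fun i j l f g =>
  mu2 i j l f (phi i j g) + mu2 i j l (phi j l f) g - phi i l (mu2 i j l f g).

Definition d2 (w : cochain2) i j l m f g h :=
  mu2 i l m f (w i j l g h) - w i j m (mu2 j l m f g) h
  + w i l m f (mu2 i j l g h) - mu2 i j m (w j l m f g) h.

Definition closed2 (w : cochain2) := forall i j l m f g h, d2 w i j l m f g h = 0.

Definition lift1 (phi : cochain1) : cochain k N := fun X0 c =>
  if c is [:: (f, X1)] then phi X0 X1 f else 0.
Definition lift2 (w : cochain2) : cochain k N := fun X0 c =>
  if c is [:: (g, X1); (f, X2)] then w X0 X1 X2 f g else 0.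

Lemma pre_nat_lift1 phi : linear1 phi -> pre_nat 1 (lift1 phi).
Proof.
move=> lp; split=> [X0 c1 X c2 x f g|X0 c].
  case: c1 => [|[? ?] c1]; last by case: c1 => [|? ?] /=; rewrite scaler0 addr0.
  by case: c2 => [|? ?] /=; rewrite ?lp // scaler0 addr0.
by case: c => [|[f X1] [|? ?]].
Qed.

Lemma pre_nat_lift2 w : bilinear2 w -> pre_nat 2 (lift2 w).
Proof.
move=> [l1 l2]; split=> [X0 c1 X c2 x f g|X0 c].
  case: c1 => [|[? ?] [|[? ?] c1]] /=.
  - by case: c2 => [|[? ?] [|? ?]] /=; rewrite ?l2 // scaler0 addr0.
  - by case: c2 => [|? ?] /=; rewrite ?l1 // scaler0 addr0.
  - by case: c1 => [|? ?] /=; rewrite scaler0 addr0.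
by case: c => [|[f X1] [|[? ?] [|? ?]]].
Qed.

Lemma pre_nat_eq0 (p : nat) (u : cochain k N) X0 c :
  pre_nat p%:Z u -> size c != p -> u X0 c = 0.
Proof. by move=> [_ hu] sz; apply: hu; rewrite subr_eq0 eqz_nat eq_sym. Qed.

(** The differential of a cochain living on chains of length p lives on chains
    of length p + 1: every term of mu1 shortens the chain by exactly one. *)
Lemma mu1_eq0 (p : nat) (u : cochain k N) X0 c :
  pre_nat p%:Z u -> size c != p.+1 -> mu1 p%:Z u X0 c = 0.
Proof.
move=> hu; rewrite /mu1; case sc: (size c) => [|d] //= neq.
have u0 X e : size e = d -> u X e = 0.
  by move=> se; rewrite (pre_nat_eq0 _ hu) // se; apply: contra neq => /eqP ->.
rewrite u0 ?size_takel ?sc // [u _ (behead c)]u0 ?size_behead ?sc //.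
rewrite /mu2 !(mulr0, mul0r) scaler0 addr0 sub0r big_nat_cond big1 ?oppr0 // => n.
rewrite andbT => /andP[_ nd].
rewrite u0 ?scaler0 // size_cat /= size_takel ?sc; last by lia.
by rewrite size_drop sc; lia.
Qed.

Lemma mu1_lift1 phi : linear1 phi -> mu1 1 (lift1 phi) = lift2 (d1 phi).
Proof.
move=> lp; apply/funext => X0; apply/funext => c.
have [/eqP sc|nsc] := boolP (size c == 2%N).
  case: c sc => [|[g j] [|[f l] [|? ?]]] // _.
  by rewrite /mu1 /= big_nat1 /= !expr0z !scale1r.
rewrite (mu1_eq0 (p := 1) _ (pre_nat_lift1 lp)) //.
by case: c nsc => [|[g j] [|[f l] [|? ?]]].
Qed.

Definition unlift2 (u : cochain k N) : cochain2 :=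
  fun i j l f g => u i [:: (g, j); (f, l)].

Lemma mu1_chain3 u i j l m f g h :
  mu1 2 u i [:: (h, j); (g, l); (f, m)] = d2 (unlift2 u) i j l m f g h.
Proof.
rewrite /mu1 /= big_nat_recr //= big_nat1 /=.
have -> : (2 : int) - 1 = 1 by [].
have -> : Posz 1 + 2 - 1 = 2 by [].
rewrite expr1z -exprnP sqrrN expr1n !scaleN1r scale1r.
rewrite /d2 /unlift2 /chain_arr /chain_obj /=; ring.
Qed.

Lemma mu1_lift2 w : bilinear2 w -> closed2 w -> mu1 2 (lift2 w) = 0.
Proof.
move=> bw cw; apply/funext => X0; apply/funext => c; rewrite -[RHS]/(0 : {poly k}).
have [/eqP sc|nsc] := boolP (size c == 3%N); last first.
  by rewrite (mu1_eq0 (p := 2) _ (pre_nat_lift2 bw)).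
case: c sc => [|[h i] [|[g j] [|[f l] [|? ?]]]] // _.
by rewrite mu1_chain3; apply: cw.
Qed.

Lemma unlift2K u : pre_nat 2 u -> lift2 (unlift2 u) = u.
Proof.
move=> pu; apply/funext => X0; apply/funext => c.
by case: c => [|[g j] [|[f l] [|? ?]]] //=; rewrite (pre_nat_eq0 (p := 2) _ pu).
Qed.

Lemma unlift2_bilinear u : pre_nat 2 u -> bilinear2 (unlift2 u).
Proof.
move=> [mu _]; split=> i j l f a g h; last exact: (mu i [::] j [:: (f, l)]).
exact: (mu i [:: (f, j)] l [::]).
Qed.

Lemma unlift2_closed u : mu1 2 u = 0 -> closed2 (unlift2 u).
Proof. by move=> du i j l m f g h; rewrite -mu1_chain3 du. Qed.

Lemma nat_trans_lift2 w : bilinear2 w -> closed2 w -> nat_trans 2 (lift2 w).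
Proof. by move=> bw cw; split; [exact: pre_nat_lift2 | exact: mu1_lift2]. Qed.

End Cochains.

Section Composition.
Variables (k : fieldType) (N : nat).
Notation obj := (obj N).
Implicit Types (i j l m : obj) (f g h : {poly k}).

Lemma Xdelta_cocycle i j l m :
  'X^(delta i j l) * 'X^(delta i l m) = 'X^(delta j l m) * 'X^(delta i j m) :> {poly k}.
Proof. by rewrite -!exprD delta_cocycle. Qed.

Lemma mu2A i j l m f g h :
  mu2 i j m (mu2 j l m f g) h = mu2 i l m f (mu2 i j l g h).
Proof.
rewrite /mu2; transitivity (f * g * h * ('X^(delta j l m) * 'X^(delta i j m))).
  by ring.
by rewrite -Xdelta_cocycle; ring.
Qed.

Lemma d1_bilinear (phi : cochain1 k N) : linear1 phi -> bilinear2 (d1 phi).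
Proof.
move=> lp; split=> i j l f x g h; rewrite /d1.
  rewrite [mu2 i j l (_ + _) (phi i j f)]mu2_linearl lp [mu2 _ _ _ (_ + _) f]mu2_linearl.
  by rewrite [mu2 _ _ _ (_ + _) f]mu2_linearl lp !scalerBr !scalerDr; ring.
rewrite lp [mu2 _ _ _ _ (_ + _)]mu2_linearr [mu2 _ _ _ _ (_ + _)]mu2_linearr.
by rewrite [mu2 _ _ _ _ (_ + _)]mu2_linearr lp !scalerBr !scalerDr; ring.
Qed.

(** The three groups of terms f g phi(h), f phi(g) h and phi(f) g h cancel up to
    the exponents, which agree by associativity; the rest cancels formally. *)
Lemma d1_closed (phi : cochain1 k N) : closed2 (d1 phi).
Proof.
move=> i j l m f g h; rewrite /d2 /d1 (mu2A i j l m f g h).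
have E := Xdelta_cocycle i j l m.
transitivity ((f * g * phi i j h + f * phi j l g * h + phi l m f * g * h)
  * ('X^(delta i j l) * 'X^(delta i l m) - 'X^(delta j l m) * 'X^(delta i j m))).
  by rewrite /mu2; ring.
by rewrite E subrr mulr0.
Qed.

(** * Pole cocycles *)

(** The coboundary of multiplication by (s_(max i j) - s_j) / X on
    Hom(T_i, T_j).  It is the sum of the increments s_(t+1) - s_t over the edges
    [t, t+1] which the path i -> j -> l traverses twice, so it is supported on
    the backtracking paths, those with delta i j l > 0. *)
Definition pole (s : nat -> k) (i j l : nat) : k :=
  s (maxn i j) + s (maxn j l) - s (maxn i l) - s j.

Definition pole_cochain s : cochain2 k N := fun i j l f g =>
  pole s i j l *: (f * g * 'X^((delta i j l).-1)).

Lemma pole_eq0 s i j l : delta i j l = 0%N -> pole s i j l = 0.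
Proof.
rewrite /delta /pole => d0.
have [[-> [-> ->]]|[-> [-> ->]]] :
  (maxn i j = j /\ maxn j l = l /\ maxn i l = l) \/
  (maxn i j = i /\ maxn j l = j /\ maxn i l = i) by lia.
all: by ring.
Qed.

(** The predecessor of the exponent is harmless: where it truncates, the
    coefficient is zero. *)
Lemma poleX s i j l :
  'X * (pole s i j l *: 'X^((delta i j l).-1)) = pole s i j l *: 'X^(delta i j l).
Proof.
case: (posnP (delta i j l)) => [d0|d0]; first by rewrite pole_eq0 // !scale0r mulr0.
by rewrite -scalerAr -exprS prednK.
Qed.

Lemma pole_cochain_bilinear s : bilinear2 (pole_cochain s).
Proof.
split=> i j l f x g h; rewrite /pole_cochain -!mul_polyC; ring.
Qed.

(** After multiplication by 'X the truncated exponent disappears, and the claim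
    becomes the cocycle identity for pole, immediate from its formula. *)
Lemma pole_cochain_closed s : closed2 (pole_cochain s).
Proof.
move=> i j l m f g h; apply/(mulfI (negbT (polyX_eq0 k))); rewrite mulr0.
pose q (a b c : obj) : {poly k} := pole s a b c *: 'X^((delta a b c).-1).
have qE (a b c : obj) : 'X * q a b c = (pole s a b c)%:P * 'X^(delta a b c).
  by rewrite poleX mul_polyC.
have pE (a b c : obj) u v : pole_cochain s a b c u v = u * v * q a b c.
  by rewrite /pole_cochain scalerAr.
have E := Xdelta_cocycle i j l m.
rewrite /d2 !pE /mu2.
transitivity (f * g * h * (('X * q i j l) * 'X^(delta i l m)
   - ('X * q i j m) * 'X^(delta j l m)
   + ('X * q i l m) * 'X^(delta i j l) - ('X * q j l m) * 'X^(delta i j m))).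
  by ring.
rewrite !qE.
transitivity (f * g * h *
  (((pole s i j l)%:P + (pole s i l m)%:P) * ('X^(delta i j l) * 'X^(delta i l m))
  - ((pole s i j m)%:P + (pole s j l m)%:P)
     * ('X^(delta j l m) * 'X^(delta i j m)))).
  by ring.
rewrite -E -mulrBl -!polyCD -polyCB.
suff -> : pole s i j l + pole s i l m - (pole s i j m + pole s j l m) = 0.
  by rewrite mul0r mulr0.
by rewrite /pole; ring.
Qed.
End Composition.

(** * Closed form of the coefficients of eta *)

Section PartialSums.
Variables (k : fieldType) (th : nat -> k).
Definition psum n : k := \sum_(0 <= t < n) th t.
Definition ppsum n : k := \sum_(0 <= v < n) psum v.+1.

Lemma psumS n : psum n.+1 = psum n + th n.
Proof. by rewrite /psum big_nat_recr. Qed.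

Lemma ppsumS n : ppsum n.+1 = ppsum n + psum n.+1.
Proof. by rewrite /ppsum big_nat_recr. Qed.

Lemma sum_psum m n : (m <= n)%N -> \sum_(m <= t < n) th t = psum n - psum m.
Proof. by move=> mn; rewrite /psum (big_cat_nat (leq0n m) mn) addrC addKr. Qed.

(** Summation by parts, written with p = j - m so that no subtraction of
    naturals is left on the right. *)
Lemma sum_down b p m :
  \sum_(1 <= t < m.+1) (2 * (b + t))%:R * th (p + m - t)%N =
  2 * (b%:R * (psum (p + m) - psum p) + ppsum (p + m) - ppsum p - m%:R * psum p).
Proof.
elim: m p => [|m IH] p; first by rewrite big_geq // addn0; ring.
rewrite big_nat_recr //= -addSnnS IH addSnnS addnK ppsumS !psumS; ring.
Qed.

Lemma sum_up b p m :
  \sum_(1 <= t < m.+1) (2 * (b + t))%:R * th (p + t)%N =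
  2 * (b%:R * (psum (p + m).+1 - psum p.+1) + m%:R * psum (p + m).+1
       - (ppsum (p + m) - ppsum p)).
Proof.
elim: m => [|m IH]; first by rewrite big_geq // addn0; ring.
rewrite big_nat_recr //= IH !addnS ppsumS !psumS; ring.
Qed.

End PartialSums.

Section EtaFormula.
Variables (k : fieldType) (N : nat).
Implicit Types (theta : 'rV[k]_N.-1) (i j l : obj N).

(** The multiplier q_n of d/ds in the coboundary by which eta theta differs from
    a pole cocycle. *)
Definition charge theta (n : nat) : k :=
  psum (thetaE theta) n + psum (thetaE theta) n.+1.

(** The part of the coefficient linear in b is the difference of the charges of
    the two ends of the right factor, and the constant part is delta times the
    charge of the source, minus twice a pole cocycle.  The shapes of the path
    i -> j -> l are checked one by one with sum_down and sum_up. *)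
Lemma coefE theta (i j l : obj N) b :
  coef theta l j b i = b%:R * (charge theta i - charge theta j)
    + (delta i j l)%:R * charge theta i
    - 2 * pole (ppsum (thetaE theta)) i j l.
Proof.
have := delta_maxn i j l; rewrite /coef /charge /pole.
move: (thetaE theta) (delta i j l) => th d.
move: (nat_of_ord i) (nat_of_ord j) (nat_of_ord l) => {}i {}j {}l.
have [/andP[il lj]|n1] := boolP (i < l <= j)%N.
  have [m jE] : exists m, j = (l + m)%N by exists (j - l)%N; lia.
  subst j.
  have [-> [-> ->]] : maxn i l = l /\ maxn i (l + m) = (l + m)%N /\ maxn (l + m) l = (l + m)%N by lia.
  move=> dE; have -> : d = m by lia.
  have -> : (b + (l + m) - l)%N = (b + m)%N by lia.
  rewrite addKn sum_down sum_psum; last by lia.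
  by rewrite !psumS; ring.
have [/andP[jl li]|n2] := boolP (j <= l < i)%N.
  have [m jE] : exists m, l = (j + m)%N by exists (l - j)%N; lia.
  subst l.
  have [-> [-> ->]] : maxn i (j + m) = i /\ maxn i j = i /\ maxn j (j + m) = (j + m)%N by lia.
  move=> dE; have -> : d = m by lia.
  have -> : (b + (j + m) - j)%N = (b + m)%N by lia.
  rewrite addKn sum_up sum_psum; last by lia.
  by rewrite !psumS; ring.
have [/andP[li ij]|n3] := boolP (l <= i < j)%N.
  have [m jE] : exists m, j = (i + m)%N by exists (j - i)%N; lia.
  subst j.
  have [-> [-> ->]] : maxn i l = i /\ maxn i (i + m) = (i + m)%N /\ maxn (i + m) l = (i + m)%N by lia.
  move=> dE; have -> : d = m by lia.
  have -> : (b + (i + m) - i)%N = (b + m)%N by lia.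
  rewrite addKn sum_down.
  by rewrite !psumS; ring.
have [/andP[ji il]|n4] := boolP (j < i <= l)%N.
  have [m jE] : exists m, i = (j + m)%N by exists (i - j)%N; lia.
  subst i.
  have [-> [-> ->]] : maxn (j + m) l = l /\ maxn (j + m) j = (j + m)%N /\ maxn j l = l by lia.
  move=> dE; have -> : d = m by lia.
  have -> : (b + (j + m) - j)%N = (b + m)%N by lia.
  rewrite addKn sum_up.
  by rewrite !psumS; ring.
have [/andP[ij jl]|n5] := boolP (i < j < l)%N.
  have [-> [-> ->]] : maxn i l = l /\ maxn i j = j /\ maxn j l = l by lia.
  move=> dE; have -> : d = 0%N by lia.
  rewrite sum_psum; last by lia.
  by rewrite !psumS; ring.
have [/andP[lj ji]|n6] := boolP (l < j < i)%N.
  have [-> [-> ->]] : maxn i l = i /\ maxn i j = i /\ maxn j l = j by lia.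
  move=> dE; have -> : d = 0%N by lia.
  rewrite sum_psum; last by lia.
  by rewrite !psumS; ring.
have -> : i = j by lia.
rewrite maxnn => dE; have -> : d = 0%N by lia.
by ring.
Qed.

(** In terms of s, multiplication by q i composed with d/ds.  Since s is central,
    d/ds is compatible with composition except for the powers of s created by
    backtracking. *)
Definition deriv_cochain (q : obj N -> {poly k}) : cochain1 k N :=
  fun i _ f => q i * f^`().

Lemma deriv_cochain_linear q : linear1 (deriv_cochain q).
Proof.
by move=> i j a f g; rewrite /deriv_cochain derivD derivZ mulrDr scalerAr.
Qed.

Lemma d1_deriv_cochain q i j l (f g : {poly k}) :
  d1 (deriv_cochain q) i j l f g =
  (q j - q i) * f^`() * g * 'X^(delta i j l)
  - (delta i j l)%:R * q i * f * g * 'X^((delta i j l).-1).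
Proof.
rewrite /d1 /deriv_cochain /mu2 !derivM derivXn -mulr_natl; ring.
Qed.

(** The coefficient coef depends on the left exponent b alone and affinely: the
    factor b turns 'X^b into its derivative. *)
Lemma eta2E theta i j l (f g : {poly k}) :
  eta2 theta i j l f g =
  (- 2) *: pole_cochain (ppsum (thetaE theta)) i j l f g
  - d1 (deriv_cochain (fun i => (charge theta i)%:P)) i j l f g.
Proof.
rewrite d1_deriv_cochain.
have -> : f^`() = \sum_(b < size f) f`_b *: (b%:R *: 'X^(b.-1)).
  rewrite -{1}[f]coefK poly_def raddf_sum /=; apply: eq_bigr => b _.
  by rewrite derivZ derivXn scaler_nat.
have fE : f = \sum_(b < size f) f`_b *: 'X^b by rewrite -{1}[f]coefK poly_def.
have gE : g = \sum_(a < size g) g`_a *: 'X^a by rewrite -{1}[g]coefK poly_def.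
set d := delta i j l; set qi := charge theta i; set qj := charge theta j.
pose P := pole (ppsum (thetaE theta)) i j l.
transitivity (\sum_(b < size f) \sum_(a < size g)
  (((qi - qj)%:P * 'X^d) * (f`_b *: (b%:R *: 'X^(b.-1))) * (g`_a *: 'X^a)
  + ((d%:R * qi - 2 * P)%:P * 'X^(d.-1)) * (f`_b *: 'X^b) * (g`_a *: 'X^a))).
  apply: eq_bigr => b _; apply: eq_bigr => a _.
  rewrite coefE -/d -/qi -/qj -/P -!mul_polyC !polyCM; clearbody qi qj.
  (* The exponent b + a + d - 1 truncates only for b = a = d = 0, and there the
     coefficient is zero; the cases d = 0 and b = 0 are treated apart. *)
  have [d0|dpos] := posnP d.
    have P0 : P = 0 by rewrite /P pole_eq0.
    rewrite d0 P0; case: (nat_of_ord b) => [|b'] /=.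
      by rewrite !polyCB !polyCD !polyCM !polyCB ?polyC0 !polyC_natr; ring.
    have -> : (b'.+1 + a + 0 - 1 = b' + a)%N by lia.
    by rewrite !polyCB !polyCD !polyCM !polyCB ?polyC0 !polyC_natr exprD; ring.
  case: (nat_of_ord b) => [|b'] /=.
    have -> : (0 + a + d - 1 = a + d.-1)%N by lia.
    by rewrite !polyCB !polyCD !polyCM !polyCB ?polyC0 !polyC_natr exprD; ring.
  have -> : (b'.+1 + a + d - 1 = b'.+1 + a + d.-1)%N by lia.
  have -> : 'X^d = 'X * 'X^(d.-1) :> {poly k} by rewrite -exprS prednK.
  by rewrite !polyCB !polyCD !polyCM !polyCB ?polyC0 !polyC_natr !exprD !exprS; ring.
under eq_bigr => b _ do rewrite big_split /= -!mulr_sumr -gE.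
rewrite big_split /= -!mulr_suml -!mulr_sumr -fE.
rewrite /pole_cochain -/d -/P -mul_polyC polyCN.
by rewrite !polyCB -!mul_polyC !polyCM polyC_natr; ring.
Qed.
End EtaFormula.

(** * The residue and its kernel *)

Section Residue.
Variables (k : fieldType) (N : nat).
Notation obj := (obj N).
Implicit Types (i j l m : obj) (f g h : {poly k}).
Implicit Types (u v w : cochain2 k N) (phi : cochain1 k N).

Lemma bilinear2B u v : bilinear2 u -> bilinear2 v ->
  bilinear2 (fun i j l f g => u i j l f g - v i j l f g).
Proof.
by move=> [u1 u2] [v1 v2]; split=> i j l f a g h; rewrite ?u1 ?v1 ?u2 ?v2 scalerBr; ring.
Qed.

Lemma closed2B u v : closed2 u -> closed2 v ->
  closed2 (fun i j l f g => u i j l f g - v i j l f g).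
Proof.
move=> cu cv i j l m f g h.
transitivity (d2 u i j l m f g h - d2 v i j l m f g h); last by rewrite cu cv subr0.
by rewrite /d2 /mu2; ring.
Qed.

Definition exact2 w :=
  exists2 phi, linear1 phi & forall i j l f g, w i j l f g = d1 phi i j l f g.

Lemma exact2_shift phi w : linear1 phi ->
  exact2 (fun i j l f g => w i j l f g - d1 phi i j l f g) -> exact2 w.
Proof.
move=> lphi [psi lpsi wE]; exists (fun i j f => phi i j f + psi i j f).
  by move=> i j a f g; rewrite lphi lpsi scalerDr; ring.
move=> i j l f g; rewrite -[LHS](subrK (d1 phi i j l f g)) wE /d1 /mu2; ring.
Qed.

(** The vertex attached to n : 'I_N.-1 is n + 1, which is interior.  The unit
    polynomials stand for the arrows of s-degree 0. *)
Definition residue w (n : 'I_N.-1) : k :=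
  let i := inord n.+1 in
  (w i (inord n) i 1 1 - w i (inord n.+2) i 1 1)`_0.

Lemma residueB u v n :
  residue (fun i j l f g => u i j l f g - v i j l f g) n = residue u n - residue v n.
Proof. by rewrite /residue !coefB; ring. Qed.

(** For a loop of length two at i, the coboundary of phi is a multiple of 'X minus
    phi(s), and the latter does not depend on the neighbour visited. *)
Lemma residue_d1 phi n : residue (d1 phi) n = 0.
Proof.
have nN : (n.+2 <= N)%N by have := ltn_ord n; lia.
have d1E i j : delta i j i = 1%N -> (d1 phi i j i 1 1)`_0 = - (phi i i 'X)`_0.
  by move=> dE; rewrite /d1 /mu2 dE !mul1r expr1 coefB coefD mulr1 !coefMX add0r sub0r.
by rewrite /residue coefB !d1E ?subrr // delta_backtrack !inordK; lia.
Qed.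

(** The equation w(f, s) = d phi (f, s) with phi(s_i) = 0 is a recursion that
    computes phi(f s) from phi(f).  The recursion may start anywhere for i != j,
    but phi(s_i) = 0 forces phi(id) = w(id, id); the same value is used for all
    j. *)
Lemma normalize_right w : bilinear2 w -> closed2 w ->
  exists2 phi, linear1 phi & forall i j f, w i i j f 'X = d1 phi i i j f 'X.
Proof.
move=> [w1 w2] cw.
pose F i j := fix F n := if n is n'.+1 then F n' * 'X - w i i j 'X^n' 'X else w i i i 1 1.
pose phi i j := poly_extend (F i j).
have lphi : linear1 phi by move=> i j; apply: poly_extend_linear.
have phiX i j f : phi i j (f * 'X) = phi i j f * 'X - w i i j f 'X.
  apply: (linear_eqX (F := fun f => phi i j (f * 'X))
    (G := fun f => phi i j f * 'X - w i i j f 'X)) => [a u v|a u v|n] /=.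
  - by rewrite mulrDl -scalerAl lphi.
  - by rewrite lphi w1 mulrDl -scalerAl scalerBr; ring.
  - by rewrite -exprSr /phi !poly_extendXn.
have phi1 i : phi i i 1 = w i i i 1 1.
  by rewrite /phi -[X in poly_extend _ X](expr0 'X) poly_extendXn.
have w1X i : w i i i 1 'X = w i i i 1 1 * 'X.
  apply/eqP; rewrite -subr_eq0; apply/eqP; rewrite -[RHS](cw i i i i 1 1 'X).
  by rewrite /d2 /mu2 deltaxx !(mul1r, mulr1); ring.
exists phi => // i j f; rewrite /d1 /mu2 !deltaxx !mulr1 phiX.
have -> : phi i i 'X = 0 by rewrite -['X]mul1r phiX phi1 w1X subrr.
by ring.
Qed.

Definition right_normal w := forall i j f, w i i j f 'X = 0.

(** The cocycle identity with s as its rightmost argument says that w is s-linear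
    on the right. *)
Lemma right_normalE w i j l f g : bilinear2 w -> closed2 w -> right_normal w ->
  w i j l f g = g * w i j l f 1.
Proof.
move=> [_ w2] cw rw; apply: polyX_linear => {g} [|g]; first exact: w2.
have := cw i i j l f g 'X; rewrite /d2 !rw /mu2 !deltaxx !mulr1 mulr0 mul0r subr0 add0r.
by move/eqP; rewrite subr_eq0 => /eqP.
Qed.

(** The derivation w(s, -), evaluated on the arrow T_i -> T_j of s-degree 0. *)
Definition left_defect w i j := w i j j 'X 1.

(** The failure of w to be s-linear on the left is governed by the derivation
    w(s, -), by the cocycle identity with s in the middle. *)
Lemma left_defectE w i j l f g : bilinear2 w -> closed2 w -> right_normal w ->
  w i j l (f * 'X) g = w i j l f g * 'X + f * g * left_defect w i j * 'X^(delta i j l).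
Proof.
move=> bw cw rw; have := cw i j j l f 'X g.
rewrite /d2 rw /mu2 !deltaxx !delta_xx !mulr1 !mul0r subr0 /left_defect.
rewrite [w i j j 'X g]right_normalE // [w i j l f ('X * g)]right_normalE //.
rewrite [w i j l f g]right_normalE // => E.
apply/eqP; rewrite eq_sym -subr_eq0; apply/eqP; rewrite -[RHS]E; ring.
Qed.

(** This is the Leibniz rule for w(s, -): by s-linearity that map multiplies each
    Hom(T_i, T_j) by a polynomial, and these are additive along composition. *)
Lemma left_defectD w i j l : bilinear2 w -> closed2 w -> right_normal w ->
  left_defect w i l = left_defect w i j + left_defect w j l.
Proof.
move=> bw cw rw; have := left_defectE i j l 1 1 bw cw rw; rewrite !mul1r => L.
have := cw i j l l 'X 1 1; rewrite /d2 /mu2 !delta_xx !mulr1 !mul1r L.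
rewrite [w i l l 'X _]right_normalE // -/(left_defect w i l) -/(left_defect w j l) => E.
apply: (mulfI (monic_neq0 (monicXn _ (delta i j l)))).
apply/eqP; rewrite -subr_eq0; apply/eqP; rewrite -[RHS]E; ring.
Qed.

Definition s_bilinear w := forall i j l f g, w i j l f g = f * g * w i j l 1 1.

Lemma normal_s_bilinear w : bilinear2 w -> closed2 w -> right_normal w ->
  (forall i j, left_defect w i j = 0) -> s_bilinear w.
Proof.
move=> bw cw rw lw i j l f g.
have -> : w i j l f g = g * w i j l f 1 by apply: right_normalE.
suff -> : w i j l f 1 = f * w i j l 1 1 by ring.
move: f; apply: (polyX_linear (F := fun f => w i j l f 1)) => [|f].
  by case: bw => + _; apply.
by rewrite left_defectE // lw; ring.
Qed.

Lemma s_bilinear_rel w i j l m : closed2 w -> s_bilinear w ->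
  'X^(delta i l m) * w i j l 1 1 - 'X^(delta j l m) * w i j m 1 1
  + 'X^(delta i j l) * w i l m 1 1 - 'X^(delta i j m) * w j l m 1 1 = 0.
Proof.
move=> cw sw; rewrite -[RHS](cw i j l m 1 1 1) /d2 /mu2.
by rewrite [w i j m (1 * 1 * _) _]sw [w i l m _ (1 * 1 * _)]sw; ring.
Qed.

(** Write W i j l for w on the arrows of s-degree 0.  Dividing the cocycle by
    s^(delta i j l) would give a 2-cocycle of the simplex on 0, ..., N, with
    primitive V i j = W 0 i j / s^(delta 0 i j) by coning off to the vertex 0.  So
    one needs s^(i - j) to divide W 0 i j for i > j.  The cocycle identity reduces
    this to neighbours i = j + 1; there the constant term of W 0 i j is carried
    from one vertex to the next by the vanishing of the residue, and is zero for
    the path 0 -> 1 -> 0 by hypothesis. *)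
Lemma s_bilinear_exact w : closed2 w -> s_bilinear w ->
  ((0 < N)%N -> (w ord0 (inord 1) ord0 1 1)`_0 = 0) ->
  (forall n, residue w n = 0) -> exact2 w.
Proof.
move=> cw sw w0 res0; have rel i j l m := s_bilinear_rel i j l m cw sw.
have below i j : i = j.+1 :> nat -> (w ord0 i j 1 1)`_0 = (w i j i 1 1)`_0.
  move=> ij; have := congr1 (fun p : {poly k} => p`_0) (rel ord0 i j i).
  rewrite !delta0E delta_backtrack.
  have [-> [-> [-> ->]]] : (j - i = 0 /\ i - j = 1 /\ maxn 1 0 = 1 /\ i - i = 0)%N by lia.
  rewrite !expr0 !expr1 !mul1r !(coefB, coefD, coefXM, coef0) subr0 addr0.
  by move/eqP; rewrite subr_eq0 => /eqP.
have above i j : j = i.+1 :> nat -> (w ord0 j i 1 1)`_0 = (w i j i 1 1)`_0.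
  move=> ij; have := congr1 (fun p : {poly k} => p`_0) (rel ord0 i j i).
  rewrite !delta0E delta_backtrack.
  have [-> [-> [-> ->]]] : (j - i = 1 /\ i - j = 0 /\ maxn 0 1 = 1 /\ i - i = 0)%N by lia.
  rewrite !expr0 !expr1 !mul1r !(coefB, coefD, coefXM, coef0) subr0 add0r.
  by move/eqP; rewrite subr_eq0 => /eqP.
have base n : (n < N)%N -> (w ord0 (inord n.+1) (inord n) 1 1)`_0 = 0.
  elim: n => [|n IH] nN.
    have -> : inord 0 = ord0 :> obj by apply/val_inj; rewrite /= inordK.
    exact: w0.
  have n' : (n < N.-1)%N by lia.
  have := res0 (Ordinal n'); rewrite /residue /= coefB.
  rewrite -below ?inordK; try lia.
  rewrite -above ?inordK; try lia.
  by rewrite IH ?sub0r => [/eqP|]; [rewrite oppr_eq0 => /eqP | lia].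
have dvd i j : 'X^(delta 0 i j) %| w ord0 i j 1 1.
  rewrite delta0E; move: {2}(i - j)%N (erefl (i - j)%N) => e; elim: e j => [|e IH] j ije.
    by rewrite ije expr0 dvd1p.
  have jlt : (j.+1 < N.+1)%N by have := ltn_ord i; lia.
  have := rel ord0 i (Ordinal jlt) j; rewrite !delta0E /=.
  have -> : (delta i j.+1 j = 0)%N by have := delta_maxn i j.+1 j; lia.
  have -> : (j.+1 - j = 1)%N by lia.
  rewrite expr0 mul1r => /eqP; rewrite subr_eq0 => /eqP.
  have IHj : (i - j.+1 = e)%N by lia.
  have := IH (Ordinal jlt) IHj; rewrite /= ije IHj => /dvdpP[q ->].
  have : 'X %| w ord0 (Ordinal jlt) j 1 1.
    have := base j jlt.
    have -> : inord j.+1 = Ordinal jlt by apply/val_inj; rewrite /= inordK.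
    rewrite inord_val => b0.
    by rewrite -['X]subr0 -polyC0 dvdp_XsubCl /root horner_coef0 b0.
  move=> /dvdpP[q' ->] E.
  apply/dvdpP; exists (q + q' - w i (Ordinal jlt) j 1 1).
  rewrite mulrBl [w i _ j 1 1 * _]mulrC -E !exprS; ring.
pose V i j := w ord0 i j 1 1 %/ 'X^(delta 0 i j).
have VE i j : w ord0 i j 1 1 = V i j * 'X^(delta 0 i j) by rewrite /V divpK.
exists (fun i j f => f * V i j) => [i j a f g|i j l f g].
  by rewrite mulrDl scalerAl.
rewrite sw /d1 /mu2.
apply: (mulfI (monic_neq0 (monicXn _ (delta 0 i l)))).
have := rel ord0 i j l; rewrite !VE => E.
have D : 'X^(delta 0 i j) * 'X^(delta 0 j l) = 'X^(delta i j l) * 'X^(delta 0 i l) :> {poly k}.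
  exact: (Xdelta_cocycle k (ord0 : obj) i j l).
transitivity (f * g * (V i j + V j l) * ('X^(delta 0 i j) * 'X^(delta 0 j l))
   - f * g * V i l * ('X^(delta i j l) * 'X^(delta 0 i l))); last first.
  by rewrite D; ring.
apply/eqP; rewrite eq_sym -subr_eq0; apply/eqP.
transitivity (f * g * (0 : {poly k})); last by rewrite mulr0.
by rewrite -E /=; ring.
Qed.

(** Additivity of the left defect makes it the difference of its values at the two
    ends, which is what the coboundary of q_i d/ds removes.  Only the differences
    of the q_i count there, so they can be shifted by a common constant c, which is
    chosen to cancel the constant term at 0 -> 1 -> 0. *)
Lemma right_normal_exact w : bilinear2 w -> closed2 w -> right_normal w ->
  (forall n, residue w n = 0) -> exact2 w.
Proof.
move=> bw cw rw res0; set c := (w ord0 (inord 1) ord0 1 1)`_0.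
pose q i := left_defect w ord0 i - c%:P.
have lq := deriv_cochain_linear q.
have q0 : q ord0 = - c%:P.
  rewrite /q; have /eqP := left_defectD ord0 ord0 ord0 bw cw rw.
  by rewrite addrC -subr_eq subrr => /eqP <-; rewrite sub0r.
apply: (exact2_shift lq).
have cw' := closed2B cw (@d1_closed _ _ _); have bw' := bilinear2B bw (d1_bilinear lq).
apply: s_bilinear_exact => //.
- apply: normal_s_bilinear => // [i j f|i j]; rewrite ?/left_defect.
    by rewrite rw d1_deriv_cochain deltaxx; ring.
  rewrite d1_deriv_cochain delta_xx derivX -/(left_defect w i j) /q.
  by rewrite (left_defectD ord0 i j bw cw rw); ring.
- move=> N_gt0; rewrite d1_deriv_cochain q0 delta_backtrack inordK //= -polyC1 derivC polyC1.
  have -> : maxn (0 - 1) (1 - 0) = 1%N by [].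
  transitivity ((w ord0 (inord 1) ord0 1 1 - c%:P)`_0).
    by apply: (congr1 (fun p : {poly k} => p`_0)); ring.
  by rewrite coefB coefC subrr.
- by move=> n; rewrite residueB res0 residue_d1 subr0.
Qed.

Theorem residue_exact w : bilinear2 w -> closed2 w ->
  (forall n, residue w n = 0) -> exact2 w.
Proof.
move=> bw cw res0; have [phi lphi phiE] := normalize_right bw cw.
apply: (exact2_shift lphi); apply: right_normal_exact.
- exact: bilinear2B bw (d1_bilinear lphi).
- exact: closed2B cw (@d1_closed _ _ _).
- by move=> i j f; rewrite phiE subrr.
- by move=> n; rewrite residueB res0 residue_d1 subr0.
Qed.
End Residue.

(** * The second cohomology group *)

Section Cohomology.
Variables (k : fieldType) (N : nat).
Notation obj := (obj N).
Implicit Types (u v phi : cochain k N) (theta : 'rV[k]_N.-1).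

Lemma cocycleP u : reflect (nat_trans 2 u) (u \in cocycle 2).
Proof. exact: asboolP. Qed.

Lemma nat_trans_linear x u v :
  nat_trans 2 u -> nat_trans 2 v -> nat_trans 2 (x *: u + v).
Proof. by move=> /cocycleP cu /cocycleP cv; apply/cocycleP; rewrite rpredD ?rpredZ. Qed.

Lemma nat_transB u v : nat_trans 2 u -> nat_trans 2 v -> nat_trans 2 (u - v).
Proof. by move=> /cocycleP cu /cocycleP cv; apply/cocycleP; rewrite rpredB. Qed.

Lemma HH_class_val (z : Zcocycle k N 2) : HH_class 2 (Zval z) = quot_class (@coboundary k N 2) z.
Proof. by rewrite /HH_class valKd. Qed.

Lemma HH_class_linear x u v : nat_trans 2 u -> nat_trans 2 v ->
  HH_class 2 (x *: u + v) = x *: HH_class 2 u + HH_class 2 v.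
Proof.
move=> /cocycleP cu /cocycleP cv.
have -> : x *: u + v = Zval (x *: MkZ cu + MkZ cv) by rewrite -[RHS]/(val _) linearP.
rewrite -[u in RHS]/(Zval (MkZ cu)) -[v in RHS]/(Zval (MkZ cv)).
by rewrite !HH_class_val linearP.
Qed.

Lemma HH_class_eq u v : nat_trans 2 u -> nat_trans 2 v ->
  HH_class 2 u = HH_class 2 v <-> exists2 phi, pre_nat 1 phi & mu1 1 phi = u - v.
Proof.
move=> /cocycleP cu /cocycleP cv.
rewrite -[u]/(Zval (MkZ cu)) -[v]/(Zval (MkZ cv)) !HH_class_val.
by rewrite quot_classE; split=> [/asboolP|] h; [|apply/asboolP].
Qed.

(** The residue as a linear form on all cochains, with values in the space of
    parameters. *)
Definition residue_row u : 'rV[k]_N.-1 := \row_n residue (unlift2 u) n.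

Lemma residue_row_linear x u v :
  residue_row (x *: u + v) = x *: residue_row u + residue_row v.
Proof.
apply/rowP => n; rewrite !mxE /residue /unlift2.
by rewrite !coefB !(coefD, coefZ) /=; ring.
Qed.

Lemma residue_rowB u v : residue_row (u - v) = residue_row u - residue_row v.
Proof. by rewrite addrC -scaleN1r residue_row_linear scaleN1r addrC. Qed.

Lemma pre_nat1_lift1 phi : pre_nat 1 phi -> exists2 f, linear1 f & phi = lift1 f.
Proof.
move=> pphi; exists (fun i j f => phi i [:: (f, j)]) => [i j a f g|].
  exact: (pphi.1 i [::] j [::]).
apply/funext => X0; apply/funext => c.
by case: c => [|[f X1] [|? ?]] //=; rewrite (pre_nat_eq0 (p := 1) _ pphi).
Qed.

Lemma residue_row_mu1 phi : pre_nat 1 phi -> residue_row (mu1 1 phi) = 0.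
Proof.
move=> /pre_nat1_lift1[f lf ->]; rewrite mu1_lift1 //.
by apply/rowP => n; rewrite !mxE residue_d1.
Qed.

Lemma residue_row_exact u : nat_trans 2 u -> residue_row u = 0 ->
  exists2 phi, pre_nat 1 phi & mu1 1 phi = u.
Proof.
move=> [pu du] ru.
have [||n|f lf fE] := @residue_exact k N (unlift2 u).
- exact: unlift2_bilinear.
- exact: unlift2_closed.
- by have := congr1 (fun r : 'rV_N.-1 => r 0 n) ru; rewrite !mxE.
exists (lift1 f); first exact: pre_nat_lift1.
rewrite mu1_lift1 // -[RHS]unlift2K //; congr lift2.
by do 5 (apply/funext => ?); rewrite fE.
Qed.

(** Residues are complete invariants of classes: residue_d1 and residue_exact. *)
Lemma HH_class_residue u v : nat_trans 2 u -> nat_trans 2 v ->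
  HH_class 2 u = HH_class 2 v <-> residue_row u = residue_row v.
Proof.
move=> cu cv.
rewrite HH_class_eq //; split=> [[phi pphi phiE]|ruv0].
  by apply/eqP; rewrite -subr_eq0 -residue_rowB -phiE residue_row_mu1.
by apply: residue_row_exact; [exact: nat_transB | rewrite residue_rowB ruv0 subrr].
Qed.

(** Any family of cocycles whose residue is proportional to its parameter is a
    coordinate system on cohomology: the residue supplies both the inverse and
    the linearity of the class in the parameter. *)
Lemma residue_section_bij (c : k) (u : 'rV[k]_N.-1 -> cochain k N) : c != 0 ->
  (forall theta, nat_trans 2 (u theta)) ->
  (forall theta, residue_row (u theta) = c *: theta) ->
  linear (fun theta => HH_class 2 (u theta)) /\
  bijective (fun theta => HH_class 2 (u theta)).
Proof.
move=> c0 cu ru; split=> [x a b|].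
  rewrite -HH_class_linear //; apply/HH_class_residue => //.
    exact: nat_trans_linear.
  by rewrite residue_row_linear !ru scalerDr !scalerA mulrC.
pose rep (z : HH k N 2) : Zcocycle k N 2 := repr z.
have repK z : HH_class 2 (Zval (rep z)) = z by rewrite HH_class_val /quot_class reprK.
have crep z : nat_trans 2 (Zval (rep z)) by apply/cocycleP; apply: valP.
exists (fun z => c^-1 *: residue_row (Zval (rep z))) => [theta|z].
  have /HH_class_residue -> // := repK (HH_class 2 (u theta)).
  by rewrite ru scalerA mulVf ?scale1r.
rewrite -[RHS]repK; apply/HH_class_residue => //.
by rewrite ru scalerA mulfV ?scale1r.
Qed.

(** The double partial sum makes theta the second difference; the sign is the
    one by which residue differs from a second difference. *)
Definition pole_class theta : cochain k N :=
  lift2 (pole_cochain (fun n => - ppsum (thetaE theta) n)).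

Lemma pole_class_nat_trans theta : nat_trans 2 (pole_class theta).
Proof. by apply: nat_trans_lift2; [apply: pole_cochain_bilinear | apply: pole_cochain_closed]. Qed.

Lemma residue_pole_class theta : residue_row (pole_class theta) = theta.
Proof.
apply/rowP => n; rewrite mxE /residue /unlift2 /pole_class /= /pole_cochain.
have nN : (n.+2 <= N)%N by have := ltn_ord n; lia.
rewrite !delta_backtrack /pole !inordK; try lia.
have [-> ->] : (maxn (n.+1 - n) (n - n.+1) = 1 /\ maxn (n.+1 - n.+2) (n.+2 - n.+1) = 1)%N by lia.
rewrite !mul1r coefB !coefZ coefXn eqxx !mulr1.
have [-> [-> [-> [-> ->]]]] : (maxn n.+1 n = n.+1 /\ maxn n n.+1 = n.+1 /\
  maxn n.+1 n.+1 = n.+1 /\ maxn n.+1 n.+2 = n.+2 /\ maxn n.+2 n.+1 = n.+2)%N by lia.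
rewrite !ppsumS !psumS /= valK; ring.
Qed.

(** The factor 2 here is why the classes of the eta theta collapse in
    characteristic 2. *)
Lemma etaE theta : eta theta = 2 *: pole_class theta
  - mu1 1 (lift1 (deriv_cochain (fun i => (charge theta i)%:P))) :> cochain k N.
Proof.
rewrite mu1_lift1; last exact: deriv_cochain_linear.
apply/funext => X0; apply/funext => c.
rewrite -[RHS]/(2 *: pole_class theta X0 c - lift2 (d1 _) X0 c).
case: c => [|[g j] [|[f l] [|? ?]]] /=; rewrite ?scaler0 ?subrr //.
rewrite eta2E; congr (_ - _); rewrite /pole_cochain !scalerA; congr (_ *: _).
by rewrite /pole; ring.
Qed.

Lemma eta_nat_trans theta : nat_trans 2 (eta theta).
Proof.
have lq := deriv_cochain_linear (fun i : obj => (charge theta i)%:P).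
rewrite etaE mu1_lift1 //; apply: nat_transB.
  apply/cocycleP; rewrite rpredZ //; apply/cocycleP; exact: pole_class_nat_trans.
by apply: nat_trans_lift2; [apply: d1_bilinear | apply: d1_closed].
Qed.

Lemma residue_eta theta : residue_row (eta theta) = 2 *: theta.
Proof.
rewrite etaE residue_rowB residue_row_mu1 ?subr0; last first.
  exact/pre_nat_lift1/deriv_cochain_linear.
rewrite -[_ *: pole_class _]addr0 residue_row_linear residue_pole_class.
rewrite -[X in residue_row X](subrr (pole_class theta)) residue_rowB subrr addr0 //.
Qed.
End Cohomology.

Theorem theorem9p4 (k : fieldType) (N : nat) (hN : (0 < N)%N) :
  (forall theta : 'rV[k]_N.-1, nat_trans 2 (eta theta)) /\
  (exists phi : {linear 'rV[k]_N.-1 -> HH k N 2}, bijective phi) /\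
  ((2 : k) != 0 ->
    let class_of_eta := fun theta : 'rV[k]_N.-1 => HH_class 2 (eta theta) in
    linear class_of_eta /\ bijective class_of_eta).
Proof.
split; first exact: eta_nat_trans.
split.
  have [| |lin bij] := @residue_section_bij k N 1 (@pole_class k N) (oner_neq0 k).
  - exact: pole_class_nat_trans.
  - by move=> theta; rewrite residue_pole_class scale1r.
  pose phi : {linear 'rV[k]_N.-1 -> HH k N 2} :=
    HB.pack (fun theta => HH_class 2 (pole_class theta)) (GRing.isLinear.Build k _ _ _ _ lin).
  by exists phi.
move=> two0; apply: (residue_section_bij two0); first exact: eta_nat_trans.
exact: residue_eta.
Qed.
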